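(* Let $R$ be a commutative ring with unity, $M$ a free $R$-module of finite rank $m$, and $N\subset M$ a submodule which is free of finite rank $k$. Let $1\le p,r,s\le m$ be integers such that $p\ge r$ and $r+s=k+1$. Consider an element $\eta\in\Lambda^pM$ and the condition (B) $\ \Lambda^sN\wedge\eta=0$. (i) Assuming that $p-r\le\operatorname{depth} I(N)-2$, we have $\eta\in\Lambda^rN\wedge\Lambda^{p-r}M$ if and only if (B) holds. (ii) Without assuming the inequality $p-r\le\operatorname{depth} I(N)-2$, if $\eta$ satisfies (B) then there exists $n>0$ such that for any $a\in I(N)$, (A') $\ a^n\eta\in\Lambda^rN\wedge\Lambda^{p-r}M$. Here the exponent $n$ can be taken independent of $\eta$ if the module of all $\eta\in\Lambda^pM$ satisfying (B) is finitely generated. Conversely, if (A') holds for some non-zero-divisor $a\in R$ (and some $n>0$), then (B) holds.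
   Context: $\Lambda^qM$ is the $q$th exterior power of $M$ ($\Lambda^0M=R$, $\Lambda^qM=0$ for $q<0$ or $q>m$). $\Lambda^rN\wedge\Lambda^{p-r}M$ (the skew-tensor product of the modules) denotes the submodule of $\Lambda^pM$ of all finite sums of products $\alpha\wedge\beta$, where $\alpha$ is an $r$-fold exterior product of elements of $N$ (taken in $\Lambda^rM$) and $\beta\in\Lambda^{p-r}M$; equivalently, if $\omega_1,\dots,\omega_k$ is a basis of $N$, the set of all sums $\sum_{1\le j_1<\dots<j_r\le k}\omega_{j_1}\wedge\cdots\wedge\omega_{j_r}\wedge\gamma_{j_1\dots j_r}$ with $\gamma_{j_1\dots j_r}\in\Lambda^{p-r}M$. Condition $\Lambda^sN\wedge\eta=0$ means $\nu_1\wedge\cdots\wedge\nu_s\wedge\eta=0$ in $\Lambda^{p+s}M$ for all $\nu_1,\dots,\nu_s\in N$. $I(N)\subset R$ is the ideal generated by the coefficients of $\Omega=\omega_1\wedge\cdots\wedge\omega_k\in\Lambda^kM$, where $\omega_1,\dots,\omega_k$ is a basis of $N$, in the basis of $\Lambda^kM$ induced by a basis of $M$; it does not depend on the choices of bases. A sequence $a_1,\dots,a_q$ in $R$ is regular if $(a_1,\dots,a_q)\ne R$ and $a_i$ is a non-zero-divisor on $R/(a_1,\dots,a_{i-1})$ for all $i$. For a proper ideal $I$, $\operatorname{depth} I$ is the supremum of the lengths of regular sequences contained in $I$; $\operatorname{depth} R=\infty$. $R$ is not assumed Noetherian. *)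

(* Defs.v *)
From HB Require Import structures.
From mathcomp Require Import all_boot all_order all_algebra generic_quotient.
From mathcomp Require Import boolp classical_sets constructive_ereal.

Set Implicit Arguments.
Unset Strict Implicit.
Unset Printing Implicit Defensive.

Import Order.TTheory GRing.Theory Num.Theory.
Local Open Scope classical_set_scope.
Local Open Scope quotient_scope.
Local Open Scope ring_scope.

Section Modules.
Variables (R : comPzRingType) (V : lmodType R).

Definition lspan (X : set V) : set V :=
  [set x | exists (n : nat) (c : 'I_n -> R) (v : 'I_n -> V),
     (forall i, X (v i)) /\ x = \sum_(i < n) c i *: v i].

Definition lin_indep (n : nat) (v : 'I_n -> V) : Prop :=
  forall c : 'I_n -> R, \sum_(i < n) c i *: v i = 0 -> forall i, c i = 0.

(* [v] is a basis of the submodule [N]; in particular [N] is a submodule. *)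
Definition is_basis (N : set V) (n : nat) (v : 'I_n -> V) : Prop :=
  N = lspan (range v) /\ lin_indep v.

Definition fin_gen (N : set V) : Prop :=
  exists (n : nat) (v : 'I_n -> V), N = lspan (range v).

End Modules.

Section Depth.
Variable R : comPzRingType.

Definition ideal_gen (X : set R) : set R := lspan (X : set R^o).

Definition regular_seq (a : seq R) : Prop :=
  ~ ideal_gen [set` a] 1 /\
  forall i, (i < size a)%N ->
    forall x, ideal_gen [set` take i a] (a`_i * x) ->
              ideal_gen [set` take i a] x.

(* Extended integers serve as the codomain, so that the value can be +oo.  For
   a proper ideal the set of lengths contains 0, hence is not empty. *)
Definition depth (I : set R) : \bar int :=
  if `[< I = setT >] then +oo%E
  else supremum 0%E
    [set (size a)%:Z%:E | a in [set a | regular_seq a /\ [set` a] `<=` I]].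

End Depth.

(* The exterior algebra of M is presented as the associative unital R-algebra
   generated by M, subject to the linearity of the inclusion of M and to
   x * x = 0 for x in M: formal expressions modulo the smallest congruence
   [ext_rel] that contains the algebra axioms and these relations.
   [ext_universal] is its universal property.  [algType] is not used because it
   excludes the zero ring. *)

Section ExteriorAlgebra.
Variables (R : comPzRingType) (M : lmodType R).

Inductive ext_term : Type :=
  | EGen of M
  | EScal of R
  | EAdd of ext_term & ext_term
  | EMul of ext_term & ext_term.

Inductive ext_rel : ext_term -> ext_term -> Prop :=
  | ER_refl x : ext_rel x x
  | ER_sym x y : ext_rel x y -> ext_rel y x
  | ER_trans x y z : ext_rel x y -> ext_rel y z -> ext_rel x z
  | ER_add x x' y y' :
      ext_rel x x' -> ext_rel y y' -> ext_rel (EAdd x y) (EAdd x' y')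
  | ER_mul x x' y y' :
      ext_rel x x' -> ext_rel y y' -> ext_rel (EMul x y) (EMul x' y')
  | ER_addA x y z : ext_rel (EAdd x (EAdd y z)) (EAdd (EAdd x y) z)
  | ER_addC x y : ext_rel (EAdd x y) (EAdd y x)
  | ER_add0 x : ext_rel (EAdd (EScal 0) x) x
  | ER_addN x : ext_rel (EAdd (EMul (EScal (- 1)) x) x) (EScal 0)
  | ER_mulA x y z : ext_rel (EMul x (EMul y z)) (EMul (EMul x y) z)
  | ER_mul1 x : ext_rel (EMul (EScal 1) x) x
  | ER_mulDl x y z : ext_rel (EMul (EAdd x y) z) (EAdd (EMul x z) (EMul y z))
  | ER_mulDr x y z : ext_rel (EMul x (EAdd y z)) (EAdd (EMul x y) (EMul x z))
  | ER_scalD a b : ext_rel (EScal (a + b)) (EAdd (EScal a) (EScal b))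
  | ER_scalM a b : ext_rel (EScal (a * b)) (EMul (EScal a) (EScal b))
  | ER_scalC a x : ext_rel (EMul (EScal a) x) (EMul x (EScal a))
  | ER_genD u v : ext_rel (EGen (u + v)) (EAdd (EGen u) (EGen v))
  | ER_genZ a u : ext_rel (EGen (a *: u)) (EMul (EScal a) (EGen u))
  | ER_alt u : ext_rel (EMul (EGen u) (EGen u)) (EScal 0).

HB.instance Definition _ := gen_eqMixin ext_term.
HB.instance Definition _ := gen_choiceMixin ext_term.

Definition ext_relb (x y : ext_term) : bool := `[< ext_rel x y >].

Lemma ext_relb_equiv : equiv_class_of ext_relb.
Proof.
split=> [x|x y|y x z].
- exact/asboolP/ER_refl.
- by apply/asboolP/asboolP => /ER_sym.
- by move=> /asboolP xy /asboolP yz; apply/asboolP/(ER_trans xy yz).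
Qed.

Canonical ext_relb_canonical := EquivRelPack ext_relb_equiv.

Definition exterior : Type := {eq_quot ext_relb}.
HB.instance Definition _ := Choice.on exterior.

Definition ext_class (x : ext_term) : exterior := \pi_{eq_quot ext_relb} x.
Definition ext_repr (u : exterior) : ext_term :=
  repr (u : {eq_quot ext_relb}).

Lemma ext_reprK u : ext_class (ext_repr u) = u.
Proof. exact: reprK. Qed.

Lemma ext_classP x y : ext_class x = ext_class y <-> ext_rel x y.
Proof.
by split=> [/eqmodP /asboolP | xy] //; apply/eqmodP/asboolP.
Qed.

Definition ext_add (u v : exterior) : exterior :=
  ext_class (EAdd (ext_repr u) (ext_repr v)).
Definition ext_mul (u v : exterior) : exterior :=
  ext_class (EMul (ext_repr u) (ext_repr v)).
Definition ext_scal (a : R) : exterior := ext_class (EScal a).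
Definition ext_scale (a : R) (u : exterior) : exterior :=
  ext_mul (ext_scal a) u.
Definition ext_gen (x : M) : exterior := ext_class (EGen x).

Lemma ext_repr_class x : ext_rel (ext_repr (ext_class x)) x.
Proof. by apply/ext_classP; rewrite ext_reprK. Qed.

Lemma ext_class_add x y :
  ext_class (EAdd x y) = ext_add (ext_class x) (ext_class y).
Proof. by apply/ext_classP/ER_sym/ER_add; apply: ext_repr_class. Qed.

Lemma ext_class_mul x y :
  ext_class (EMul x y) = ext_mul (ext_class x) (ext_class y).
Proof. by apply/ext_classP/ER_sym/ER_mul; apply: ext_repr_class. Qed.

Lemma ext_ind (P : exterior -> Prop) :
  (forall x, P (ext_class x)) -> forall u, P u.
Proof. by move=> PC u; rewrite -(ext_reprK u). Qed.

Let classE := (ext_class_add, ext_class_mul).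

Lemma ext_addA : associative ext_add.
Proof.
elim/ext_ind=> x; elim/ext_ind=> y; elim/ext_ind=> z.
by rewrite -!classE; apply/ext_classP/ER_addA.
Qed.

Lemma ext_addC : commutative ext_add.
Proof.
elim/ext_ind=> x; elim/ext_ind=> y.
by rewrite -!classE; apply/ext_classP/ER_addC.
Qed.

Lemma ext_add0 : left_id (ext_scal 0) ext_add.
Proof. by elim/ext_ind=> x; rewrite -!classE; apply/ext_classP/ER_add0. Qed.

Lemma ext_addN :
  left_inverse (ext_scal 0) (ext_scale (- 1)) ext_add.
Proof.
by elim/ext_ind=> x; rewrite /ext_scale /ext_scal -!classE; apply/ext_classP/ER_addN.
Qed.

HB.instance Definition _ :=
  GRing.isZmodule.Build exterior ext_addA ext_addC ext_add0 ext_addN.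

Lemma ext_mulA : associative ext_mul.
Proof.
elim/ext_ind=> x; elim/ext_ind=> y; elim/ext_ind=> z.
by rewrite -!classE; apply/ext_classP/ER_mulA.
Qed.

Lemma ext_scalC a u : ext_mul (ext_scal a) u = ext_mul u (ext_scal a).
Proof.
by elim/ext_ind: u => x; rewrite -!classE; apply/ext_classP/ER_scalC.
Qed.

Lemma ext_mul1l : left_id (ext_scal 1) ext_mul.
Proof. by elim/ext_ind=> x; rewrite -!classE; apply/ext_classP/ER_mul1. Qed.

Lemma ext_mul1r : right_id (ext_scal 1) ext_mul.
Proof. by move=> u; rewrite -ext_scalC ext_mul1l. Qed.

Lemma ext_mulDl : left_distributive ext_mul ext_add.
Proof.
elim/ext_ind=> x; elim/ext_ind=> y; elim/ext_ind=> z.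
by rewrite -!classE; apply/ext_classP/ER_mulDl.
Qed.

Lemma ext_mulDr : right_distributive ext_mul ext_add.
Proof.
elim/ext_ind=> x; elim/ext_ind=> y; elim/ext_ind=> z.
by rewrite -!classE; apply/ext_classP/ER_mulDr.
Qed.

HB.instance Definition _ :=
  GRing.Zmodule_isPzRing.Build exterior
    ext_mulA ext_mul1l ext_mul1r ext_mulDl ext_mulDr.

Lemma ext_scalM a b : ext_scal (a * b) = ext_mul (ext_scal a) (ext_scal b).
Proof. by rewrite /ext_scal -!classE; apply/ext_classP/ER_scalM. Qed.

Lemma ext_scalD a b : ext_scal (a + b) = ext_add (ext_scal a) (ext_scal b).
Proof. by rewrite /ext_scal -!classE; apply/ext_classP/ER_scalD. Qed.

Lemma ext_scaleA a b u :
  ext_scale a (ext_scale b u) = ext_scale (a * b) u.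
Proof. by rewrite /ext_scale ext_scalM ext_mulA. Qed.

Lemma ext_scale1 : left_id 1 ext_scale.
Proof. exact: ext_mul1l. Qed.

Lemma ext_scaleDr : right_distributive ext_scale +%R.
Proof. by move=> a u v; apply: ext_mulDr. Qed.

Lemma ext_scaleDl u : {morph ext_scale^~ u : a b / a + b}.
Proof. by move=> a b; rewrite /ext_scale ext_scalD; apply: ext_mulDl. Qed.

HB.instance Definition _ :=
  GRing.Zmodule_isLmodule.Build R exterior
    ext_scaleA ext_scale1 ext_scaleDr ext_scaleDl.

Lemma ext_scalerAl (a : R) (u v : exterior) : a *: (u * v) = (a *: u) * v.
Proof. exact: ext_mulA. Qed.

Lemma ext_scalerAr (a : R) (u v : exterior) : a *: (u * v) = u * (a *: v).
Proof.
transitivity (ext_mul (ext_mul u (ext_scal a)) v); last first.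
  exact/esym/ext_mulA.
by rewrite -ext_scalC; apply: ext_mulA.
Qed.

Lemma ext_gen_is_linear : linear ext_gen.
Proof.
move=> a x y; change (ext_gen (a *: x + y) =
  ext_add (ext_mul (ext_scal a) (ext_gen x)) (ext_gen y)).
rewrite /ext_gen /ext_scal -!classE; apply/ext_classP/(ER_trans (ER_genD _ _)).
exact: ER_add (ER_genZ _ _) (ER_refl _).
Qed.

HB.instance Definition _ :=
  GRing.isLinear.Build R M exterior _ ext_gen ext_gen_is_linear.

Lemma ext_gen_sqr x : ext_gen x * ext_gen x = 0.
Proof.
change (ext_mul (ext_gen x) (ext_gen x) = ext_scal 0).
by rewrite /ext_scal /ext_gen -!classE; apply/ext_classP/ER_alt.
Qed.

(* An R-algebra is here a ring [A] with a ring morphism from [R] to its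
   center. *)
Theorem ext_universal (A : pzRingType) (phi : {rmorphism R -> A})
    (f : {additive M -> A}) :
  (forall a x, phi a * x = x * phi a) ->
  (forall a x, f (a *: x) = phi a * f x) ->
  (forall x, f x * f x = 0) ->
  exists g : {rmorphism exterior -> A},
    [/\ forall a u, g (a *: u) = phi a * g u,
        forall x, g (ext_gen x) = f x
      & forall h : {rmorphism exterior -> A},
          (forall a u, h (a *: u) = phi a * h u) ->
          (forall x, h (ext_gen x) = f x) -> h =1 g].
Proof.
move=> phiC fZ f2.
pose ev := fix ev t := match t with
  | EGen x => f x | EScal a => phi a
  | EAdd s t => ev s + ev t | EMul s t => ev s * ev t end.
have evP s t : ext_rel s t -> ev s = ev t.
  elim=> //=.
  - by move=> ? ? ? _ -> _ ->.
  - by move=> ? ? ? ? _ -> _ ->.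
  - by move=> ? ? ? ? _ -> _ ->.
  - by move=> *; rewrite addrA.
  - by move=> *; rewrite addrC.
  - by move=> *; rewrite rmorph0 add0r.
  - by move=> *; rewrite rmorphN1 rmorph0 mulN1r addNr.
  - by move=> *; rewrite mulrA.
  - by move=> *; rewrite rmorph1 mul1r.
  - by move=> *; rewrite mulrDl.
  - by move=> *; rewrite mulrDr.
  - by move=> *; rewrite rmorphD.
  - by move=> *; rewrite rmorphM.
  - by move=> *; rewrite raddfD.
  - by move=> *; rewrite rmorph0.
pose g0 u := ev (ext_repr u).
have g0E t : g0 (ext_class t) = ev t by exact/evP/ext_repr_class.
have g0B : zmod_morphism g0.
  have g0D u v : g0 (u + v) = g0 u + g0 v by exact: g0E.
  move=> u v; apply/eqP; rewrite eq_sym subr_eq eq_sym.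
  by rewrite -g0D subrK.
have g0M : monoid_morphism g0.
  split; last by move=> u v; exact: g0E.
  by rewrite [LHS]g0E /= rmorph1.
pose gA := GRing.isZmodMorphism.Build _ _ g0 g0B.
pose gM := GRing.isMonoidMorphism.Build _ _ g0 g0M.
pose g : {rmorphism exterior -> A} := HB.pack g0 gA gM.
exists g; split=> [a u|x|h hZ hx u].
- rewrite [LHS]g0E /=; congr (_ * _).
  exact: (evP _ (EScal a) (ext_repr_class _)).
- exact: g0E.
- have hS a : h (ext_class (EScal a)) = phi a.
    have -> : ext_class (EScal a) = a *: (1 : exterior).
      exact/esym/ext_mul1r.
    by rewrite hZ rmorph1 mulr1.
  elim/ext_ind: u => t; rewrite [RHS]g0E.
  elim: t => [x|a|s IHs t IHt|s IHs t IHt] /=.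
  + exact: hx.
  + exact: hS.
  + by rewrite -IHs -IHt -rmorphD; congr (h _); exact: ext_class_add.
  + by rewrite -IHs -IHt -rmorphM; congr (h _); exact: ext_class_mul.
Qed.

Definition wedge (q : nat) (v : 'I_q -> M) : exterior :=
  \prod_(i < q) ext_gen (v i).

Definition ext_pow (q : nat) : set exterior :=
  lspan (range (@wedge q)).

(* [skew_tensor N r q] is the module written \Lambda^r N /\ \Lambda^q M. *)
Definition skew_tensor (N : set M) (r q : nat) : set exterior :=
  [set x | exists (n : nat) (alpha beta : 'I_n -> exterior),
     [/\ forall i, exists2 v : 'I_r -> M,
           (forall j, N (v j)) & alpha i = wedge v,
         forall i, ext_pow q (beta i)
       & x = \sum_(i < n) alpha i * beta i]].

(* \Lambda^s N /\ eta = 0 *)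
Definition annihilates (N : set M) (s : nat) (eta : exterior) : Prop :=
  forall nu : 'I_s -> M, (forall i, N (nu i)) -> wedge nu * eta = 0.

(* The element of the basis of \Lambda^k M (k = #|S|) induced by [e]; the
   factors come in increasing order of the index. *)
Definition basis_wedge (m : nat) (e : 'I_m -> M) (S : {set 'I_m}) : exterior :=
  \prod_(i in S) ext_gen (e i).

(* I(N), for [e] a basis of M and [omega] a basis of N.  The coordinates [c] of
   omega_0 /\ ... /\ omega_(k-1) exist and are unique, [e] being a basis. *)
Definition coef_ideal (m : nat) (e : 'I_m -> M) (k : nat) (omega : 'I_k -> M) :
    set R :=
  [set a | exists c : {set 'I_m} -> R,
     wedge omega = \sum_(S : {set 'I_m} | #|S| == k) c S *: basis_wedge e S /\
     ideal_gen [set c S | S in [set S : {set 'I_m} | #|S| = k]] a].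

End ExteriorAlgebra.

Arguments ext_pow {R} M q.

(* Main.v *)
Require Import Defs.
From HB Require Import structures.
From mathcomp Require Import all_boot all_order all_algebra.
From mathcomp Require Import boolp classical_sets constructive_ereal.

(** If a lies in I(N), there are linear forms f_i on M with f_i(omega_j) = a
delta_ij.  Let iota_i be the contraction by f_i, an antiderivation of the
exterior algebra; then a eta = omega_i /\ iota_i(eta) + iota_i(omega_i /\ eta).
Iterating over i = 0, .., k-1 writes a^k eta as a sum of terms each of which
either carries r factors omega_i or is a contraction of some product of s of the
omega_i with eta, and (B) kills the latter.  Hence n = k works in (ii), uniformly
in eta and a.  For (i) one descends along a regular sequence in I(N), working
modulo an ideal J of R throughout. *)

Set Implicit Arguments.
Unset Strict Implicit.
Unset Printing Implicit Defensive.

Import Order.TTheory GRing.Theory Num.Theory.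
Local Open Scope classical_set_scope.
Local Open Scope ring_scope.

(** The descent is governed by the number D = p - r + 1. At D = 0 the module is zero, so a^k eta is
    0 modulo J, and cancelling a^k costs one regular element. A larger D calls D - 1 twice: modulo J
    + (a^k) with the rest of the sequence, and modulo J with the whole sequence and r + 1 for r.
    Hence a sequence of length D + 1 = p - r + 2 suffices, which is the depth bound. Since division
    yields a^k and not a, the rest of the sequence must stay regular modulo J + (a^k). The ring R/J
    is never formed: M, the forms and the exterior algebra stay over R, and congruence is tested by
    R-linear functionals. As the exterior algebra is given by generators and relations, its maps
    come from the universal property, and the independence of its basis is itself obtained from
    contractions. *)

(** * Spans and their images under linear maps *)

Section LinearSpan.
Variables (R : comPzRingType) (V : lmodType R).
Implicit Types X Y : set V.

Lemma lspan_sub X : X `<=` lspan X.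
Proof.
move=> x Xx; exists 1%N, (fun=> 1), (fun=> x); split=> //.
by rewrite big_ord1 scale1r.
Qed.

Lemma lspan0 X : lspan X 0.
Proof.
exists 0%N, (fun=> 0), (fun=> 0); split; first by case.
by rewrite big_ord0.
Qed.

Lemma lspanD X x y : lspan X x -> lspan X y -> lspan X (x + y).
Proof.
move=> [n [c [v [Xv ->]]]] [n' [c' [v' [Xv' ->]]]].
exists (n + n')%N, (fun i => match split i with inl j => c j | inr j => c' j end),
  (fun i => match split i with inl j => v j | inr j => v' j end); split.
  by move=> i; case: (split i).
rewrite big_split_ord; congr (_ + _); apply: eq_bigr => i _.
  by case: (split_ordP (lshift n' i)) => j /eqP;
    rewrite ?eq_lrshift // eq_lshift => /eqP ->.
by case: (split_ordP (rshift n i)) => j /eqP;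
  rewrite ?eq_rlshift // eq_rshift => /eqP ->.
Qed.

Lemma lspanZ X a x : lspan X x -> lspan X (a *: x).
Proof.
move=> [n [c [v [Xv ->]]]]; exists n, (fun i => a * c i), v; split=> //.
by rewrite scaler_sumr; apply: eq_bigr => i _; rewrite scalerA.
Qed.

Lemma lspan_sum X (I : Type) (l : seq I) (P : pred I) (F : I -> V) :
  (forall i, P i -> lspan X (F i)) -> lspan X (\sum_(i <- l | P i) F i).
Proof. by move=> XF; apply: big_ind => //; [exact: lspan0|exact: lspanD]. Qed.

Lemma lspan_ind X (P : V -> Prop) :
  P 0 -> (forall x y, P x -> P y -> P (x + y)) ->
  (forall a x, P x -> P (a *: x)) -> X `<=` P -> lspan X `<=` P.
Proof.
move=> P0 PD PZ XP _ [n [c [v [Xv ->]]]].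
by apply: big_ind => // i _; apply/PZ/XP.
Qed.

End LinearSpan.

Lemma lspan_linear (R : comPzRingType) (V W : lmodType R) (phi : {linear V -> W})
    (X : set V) (Y : set W) :
  (forall x, X x -> lspan Y (phi x)) -> forall x, lspan X x -> lspan Y (phi x).
Proof.
move=> XY; apply: lspan_ind => //.
- by rewrite linear0; exact: lspan0.
- by move=> x y Yx Yy; rewrite linearD; exact: lspanD.
- by move=> a x Yx; rewrite linearZ; exact: lspanZ.
Qed.

(** * Contraction and augmentation, from the universal property *)

Section Exterior.
Variables (R : comPzRingType) (M : lmodType R).
Local Notation E := (exterior M).

Lemma exterior_ind (P : E -> Prop) :
  (forall a : R, P (a *: (1 : E))) -> (forall x, P (ext_gen x)) ->
  (forall u v, P u -> P v -> P (u + v)) ->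
  (forall u v, P u -> P v -> P (u * v)) -> forall u, P u.
Proof.
move=> Pscal Pgen PD PM; elim/ext_ind; elim=> [x|a|s Ps t Pt|s Ps t Pt].
- exact: Pgen.
- suff <- : a *: (1 : E) = ext_class (EScal M a) by [].
  exact: ext_mul1r.
- rewrite ext_class_add; exact: PD.
- rewrite ext_class_mul; exact: PM.
Qed.

Lemma ext_mulZ a b (u v : E) : (a *: u) * (b *: v) = (a * b) *: (u * v).
Proof. by rewrite -ext_scalerAl -ext_scalerAr scalerA. Qed.

Lemma ext_gen_anticomm (x y : M) :
  ext_gen x * ext_gen y = - (ext_gen y * ext_gen x) :> E.
Proof.
apply/eqP; rewrite -addr_eq0; apply/eqP.
have := ext_gen_sqr (x + y).
by rewrite linearD mulrDl !mulrDr !ext_gen_sqr add0r addr0.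
Qed.

(* The multiplicative extension of x |-> [[-x, f x], [0, x]] to the exterior
   algebra has the contraction by f as its upper right entry. *)
Lemma contraction_exists (f : {scalar M}) :
  exists iota : {linear E -> E}, iota 1 = 0 /\
    forall x u, iota (ext_gen x * u) = f x *: u - ext_gen x * iota u.
Proof.
pose A := 'M[E]_2; pose i0 : 'I_2 := ord0; pose i1 : 'I_2 := ord_max.
have mulE (B C : A) i j : (B * C) i j = B i i0 * C i0 j + B i i1 * C i1 j.
  rewrite [LHS]mxE big_ord_recl big_ord1.
  by congr (_ + B i _ * C _ j); apply: val_inj.
have ord2 (i : 'I_2) : i = i0 \/ i = i1.
  by case: i => [[|[|i]] lti]; [left|right|]; (try by []); apply: val_inj.
have A_eq (B C : A) : B i0 i0 = C i0 i0 -> B i0 i1 = C i0 i1 ->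
    B i1 i0 = C i1 i0 -> B i1 i1 = C i1 i1 -> B = C.
  move=> e00 e01 e10 e11; apply/matrixP => i j.
  by case: (ord2 i) => ->; case: (ord2 j) => ->.
pose phi0 (a : R) : A := (a *: (1 : E))%:M.
have phi00 a : phi0 a i0 i0 = a *: (1 : E) by rewrite mxE.
have phi01 a : phi0 a i0 i1 = 0 by rewrite mxE.
have phi10 a : phi0 a i1 i0 = 0 by rewrite mxE.
have phi11 a : phi0 a i1 i1 = a *: (1 : E) by rewrite mxE.
have phi0B : zmod_morphism phi0.
  by move=> a b; rewrite /phi0 scalerBl raddfB.
have phi0M : monoid_morphism phi0.
  split; first by rewrite /phi0 scale1r.
  by move=> a b; apply: A_eq; rewrite mulE !(phi00, phi01, phi10, phi11)
    !(mulr0, mul0r, addr0, add0r) ?ext_mulZ ?mulr1.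
pose phiA := GRing.isZmodMorphism.Build _ _ phi0 phi0B.
pose phiM := GRing.isMonoidMorphism.Build _ _ phi0 phi0M.
pose phi : {rmorphism R -> A} := HB.pack phi0 phiA phiM.
pose F0 (x : M) : A := \matrix_(i, j)
  if i == i0 then if j == i0 then - ext_gen x else f x *: (1 : E)
  else if j == i0 then 0 else ext_gen x.
have F00 x : F0 x i0 i0 = - ext_gen x by rewrite mxE.
have F01 x : F0 x i0 i1 = f x *: (1 : E) by rewrite mxE.
have F10 x : F0 x i1 i0 = 0 by rewrite mxE.
have F11 x : F0 x i1 i1 = ext_gen x by rewrite mxE.
have F0B : zmod_morphism F0.
  have subE (B C : A) i j : (B - C) i j = B i j - C i j by rewrite !mxE.
  move=> x y; apply: A_eq; rewrite subE !(F00, F01, F10, F11) ?linearB ?subr0 //.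
  by rewrite scalerBl.
pose F : {additive M -> A} :=
  HB.pack F0 (GRing.isZmodMorphism.Build _ _ F0 F0B).
have phiE a (B : A) i j : (phi0 a * B) i j = a *: B i j.
  case: (ord2 i) => ->.
  - by rewrite mulE phi00 phi01 mul0r addr0 -ext_scalerAl mul1r.
  - by rewrite mulE phi10 phi11 mul0r add0r -ext_scalerAl mul1r.
have Ephi a (B : A) i j : (B * phi0 a) i j = a *: B i j.
  case: (ord2 j) => ->.
  - by rewrite mulE phi00 phi10 mulr0 addr0 -ext_scalerAr mulr1.
  - by rewrite mulE phi01 phi11 mulr0 add0r -ext_scalerAr mulr1.
have phiC a (B : A) : phi a * B = B * phi a.
  by apply/matrixP => i j; rewrite phiE Ephi.
have FZ a x : F (a *: x) = phi a * F x.
  apply: A_eq; rewrite phiE !(F00, F01, F10, F11) ?scaler0 //.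
  - by rewrite linearZ scalerN.
  - by rewrite scalarZ scalerA.
  - by rewrite linearZ.
(* The minus sign in the upper left entry makes the two off-diagonal terms of the square cancel. *)
have F2 x : F x * F x = 0.
  apply: A_eq; rewrite mulE !(F00, F01, F10, F11) !mxE
    ?(mulr0, mul0r, add0r, addr0) ?ext_gen_sqr //.
    by rewrite mulrNN ext_gen_sqr.
  by rewrite mulNr -(ext_scalerAr (f x)) -(ext_scalerAl (f x)) mul1r mulr1 addNr.
have [g [gZ gF _]] := ext_universal phiC FZ F2.
(* The bottom row of [g u] being (0, u), the upper right entry of [F x * g u] is the antiderivation
   formula. *)
have g1x u : g u i1 i0 = 0 /\ g u i1 i1 = u.
  elim/exterior_ind: u => [a|x|u v [u0 u1] [v0 v1]|u v [u0 u1] [v0 v1]].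
  - by rewrite gZ rmorph1 mulr1 phi10 phi11.
  - by rewrite gF F10 F11.
  - by rewrite rmorphD !mxE u0 u1 v0 v1 addr0.
  - by rewrite rmorphM !mulE u0 u1 v0 v1 mulr0 !mul0r !add0r.
pose h (u : E) := g u i0 i1.
have hlin : linear h.
  by move=> a u v; rewrite /h rmorphD gZ mxE phiE.
pose iota : {linear E -> E} := HB.pack h (GRing.isLinear.Build R E E _ h hlin).
exists iota; split=> [|x u]; first by rewrite /= /h rmorph1 mxE.
rewrite /= /h rmorphM mulE gF F00 F01 (g1x u).2 -(ext_scalerAl (f x)) mul1r.
by rewrite mulNr addrC.
Qed.

(** The algebra morphism to R that kills M, that is, the projection to degree 0; it is where
    iterated contractions end. *)
Lemma augmentation_exists :
  exists eps : {scalar E}, eps 1 = 1 /\ forall x u, eps (ext_gen x * u) = 0.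
Proof.
pose phi : {rmorphism R -> R} := idfun.
pose F0 (x : M) : R := 0.
have F0B : zmod_morphism F0 by move=> x y; rewrite subr0.
pose F : {additive M -> R} :=
  HB.pack F0 (GRing.isZmodMorphism.Build _ _ F0 F0B).
have phiC a x : phi a * x = x * phi a by rewrite mulrC.
have FZ a x : F (a *: x) = phi a * F x by rewrite [RHS]mulr0.
have F2 x : F x * F x = 0 by rewrite mulr0.
have [g [gZ gF _]] := ext_universal phiC FZ F2.
have glin : scalar g by move=> a u v; rewrite rmorphD gZ.
pose eps : {scalar E} := HB.pack (g : E -> R) (GRing.isLinear.Build R E R *%R g glin).
exists eps; split; first exact: rmorph1.
by move=> x u; rewrite /= rmorphM gF mul0r.
Qed.

End Exterior.

(** * Products indexed by sequences, and their degrees *)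

Section WedgeSeq.
Variables (R : comPzRingType) (M : lmodType R).
Local Notation E := (exterior M).

(** Left multiplication is named so that it can carry a linear structure and be fed to lemmas about
    linear maps. *)
Definition ext_lmul (u v : E) : E := u * v.

Lemma ext_lmul_is_linear u : linear (ext_lmul u).
Proof. by move=> a x y; rewrite /ext_lmul mulrDr -ext_scalerAr. Qed.

HB.instance Definition _ u :=
  GRing.isLinear.Build R E E _ (ext_lmul u) (ext_lmul_is_linear u).

Section Family.
Variables (I : eqType) (v : I -> M).
Implicit Types s t : seq I.

(** Sequences of indices, unlike families over ordinals, can be concatenated, permuted and shortened
    directly. *)
Definition wedge_seq t : E := \prod_(i <- t) ext_gen (v i).

Lemma wedge_seq_nil : wedge_seq [::] = 1.
Proof. exact: big_nil. Qed.

Lemma wedge_seq_cons i t : wedge_seq (i :: t) = ext_gen (v i) * wedge_seq t.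
Proof. exact: big_cons. Qed.

Lemma wedge_seq_cat s t : wedge_seq (s ++ t) = wedge_seq s * wedge_seq t.
Proof. exact: big_cat. Qed.

Lemma wedge_seq_rem i t : i \in t ->
  exists n, wedge_seq t = (-1) ^+ n *: wedge_seq (i :: rem i t).
Proof.
elim: t => // j t IHt; rewrite inE /= [i == j]eq_sym.
case: eqVneq => [-> _|_ /= /IHt [n wt]]; first by exists 0%N; rewrite scale1r.
exists n.+1; rewrite wedge_seq_cons wt !wedge_seq_cons -(ext_scalerAr (_ ^+ n)).
by rewrite !mulrA ext_gen_anticomm mulNr exprS mulN1r scaleNr scalerN.
Qed.

Lemma wedge_seq_perm s t : perm_eq s t ->
  exists n, wedge_seq s = (-1) ^+ n *: wedge_seq t.
Proof.
elim: s t => [|i s IHs] t st.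
  by rewrite perm_sym in st; rewrite (perm_nilP st); exists 0%N; rewrite scale1r.
have ti : i \in t by rewrite -(perm_mem st) mem_head.
have /IHs [n ws] : perm_eq s (rem i t).
  by rewrite -(perm_cons i) (permPl st) perm_to_rem.
have [n' wt] := wedge_seq_rem ti; exists (n + n')%N.
rewrite wt scalerA exprD -mulrA -expr2 sqrr_sign mulr1.
by rewrite !wedge_seq_cons ws -(ext_scalerAr (_ ^+ n)).
Qed.

Lemma wedge_seq_dup t : ~~ uniq t -> wedge_seq t = 0.
Proof.
elim: t => //= i t IHt; rewrite negb_and negbK wedge_seq_cons.
case/orP=> [/wedge_seq_rem [n ->]|/IHt ->]; last by rewrite mulr0.
rewrite -(ext_scalerAr (_ ^+ n)) wedge_seq_cons mulrA ext_gen_sqr mul0r.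
exact: scaler0.
Qed.

(** Each factor lies in the kernel of f, so the contraction passes it at the cost of a sign. *)
Lemma contraction_wedge_seq (f : {scalar M}) (iota : {linear E -> E}) :
  (forall x u, iota (ext_gen x * u) = f x *: u - ext_gen x * iota u) ->
  forall t u, (forall i, i \in t -> f (v i) = 0) ->
    iota (wedge_seq t * u) = (-1) ^+ size t *: (wedge_seq t * iota u).
Proof.
move=> iotaM t u; elim: t => [|i t IHt] ft.
  by rewrite wedge_seq_nil !mul1r scale1r.
rewrite wedge_seq_cons -mulrA iotaM ft ?mem_head // scale0r sub0r.
rewrite IHt => [|j jt]; last by rewrite ft // inE jt orbT.
by rewrite -(ext_scalerAr (_ ^+ _)) exprS mulN1r scaleNr mulrA.
Qed.

End Family.

Lemma wedge_seq_map (I J : eqType) (g : J -> I) (v : I -> M) (t : seq J) :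
  wedge_seq v (map g t) = wedge_seq (v \o g) t.
Proof. exact: big_map. Qed.

Lemma wedge_enum n (v : 'I_n -> M) : wedge v = wedge_seq v (enum 'I_n).
Proof. by rewrite /wedge_seq enumT. Qed.

Lemma wedge_seq_tuple (I : eqType) (v : I -> M) n (t : n.-tuple I) :
  wedge_seq v t = wedge (fun i => v (tnth t i)).
Proof. by rewrite wedge_enum -[in LHS](map_tnth_enum t) wedge_seq_map. Qed.

Lemma wedge_recl n (v : 'I_n.+1 -> M) :
  wedge v = ext_gen (v ord0) * wedge (v \o lift ord0).
Proof. exact: big_ord_recl. Qed.

Lemma ext_pow0 u : ext_pow M 0 u -> exists a, u = a *: (1 : E).
Proof.
apply: (lspan_ind (P := fun u => exists a, u = a *: (1 : E))).
- by exists 0; rewrite scale0r.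
- by move=> _ _ [a ->] [b ->]; exists (a + b); rewrite scalerDl.
- by move=> c _ [a ->]; exists (c * a); rewrite scalerA.
- by move=> _ [v _ <-]; exists 1; rewrite scale1r; exact: big_ord0.
Qed.

Lemma ext_pow1 : ext_pow M 0 (1 : E).
Proof.
by apply: lspan_sub; exists (fun=> 0) => //; exact: big_ord0.
Qed.

Lemma ext_pow_gen q x u : ext_pow M q u -> ext_pow M q.+1 (ext_gen x * u).
Proof.
apply: (lspan_linear (phi := ext_lmul (ext_gen x))) => _ [v _ <-].
(* The family with x at position 0, followed by v. *)
apply: lspan_sub; exists (fun i => oapp v x (unlift ord0 i)) => //.
rewrite wedge_recl unlift_none; congr (_ * _).
by apply: eq_bigr => i _; rewrite /= liftK.
Qed.

Lemma ext_pow_wedge_seq (I : eqType) (v : I -> M) t q u :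
  ext_pow M q u -> ext_pow M (size t + q) (wedge_seq v t * u).
Proof.
move=> qu; elim: t => [|i t IHt]; first by rewrite wedge_seq_nil mul1r.
by rewrite wedge_seq_cons -mulrA; exact: ext_pow_gen.
Qed.

Lemma contraction_ext_pow (f : {scalar M}) (iota : {linear E -> E}) :
  iota 1 = 0 ->
  (forall x u, iota (ext_gen x * u) = f x *: u - ext_gen x * iota u) ->
  (forall u, ext_pow M 0 u -> iota u = 0) /\
  forall q u, ext_pow M q.+1 u -> ext_pow M q (iota u).
Proof.
move=> iota1 iotaM.
have iota0 u : ext_pow M 0 u -> iota u = 0.
  by move=> /ext_pow0 [a ->]; rewrite linearZ /= iota1 scaler0.
split=> // q u; apply: lspan_linear => _ [v _ <-].
elim: q v => [|q IHq] v; rewrite wedge_recl iotaM -scaleN1r.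
  rewrite iota0; last by apply: lspan_sub; exists (v \o lift ord0).
  by rewrite mulr0 scaler0 addr0; apply/lspanZ/lspan_sub; exists (v \o lift ord0).
apply: lspanD; last by apply/lspanZ/ext_pow_gen/IHq.
by apply/lspanZ/lspan_sub; exists (v \o lift ord0).
Qed.

(** * The modules of sums with r factors from a given list *)

Section SkewSeq.
Variables (I : eqType) (v : I -> M).
Implicit Types l t : seq I.

(* The total degree [p] is the parameter, so that [p < r] gives the zero
   module: \Lambda^(p - r) M = 0 for a negative exponent. *)
Definition skew_seq l r p : set E :=
  lspan [set u | exists t q beta, [/\ size t = r, {subset t <= l},
    (r + q)%N = p, ext_pow M q beta & u = wedge_seq v t * beta]].

Lemma skew_seq_ext_pow l r p : skew_seq l r p `<=` ext_pow M p.
Proof.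
apply: lspan_ind.
- exact: lspan0.
- by move=> *; exact: lspanD.
- by move=> *; exact: lspanZ.
- by move=> _ [t [q [beta [<- _ <- qb ->]]]]; exact: ext_pow_wedge_seq.
Qed.

Lemma skew_seq0 l p u : ext_pow M p u -> skew_seq l 0 p u.
Proof.
move=> pu; apply: lspan_sub; exists [::], p, u; split=> //.
by rewrite wedge_seq_nil mul1r.
Qed.

Lemma skew_seq_degenerate l r p u : (p < r)%N -> skew_seq l r p u -> u = 0.
Proof.
move=> pr; apply: (lspan_ind (P := fun u => u = 0)) => //.
- by move=> _ _ -> ->; rewrite addr0.
- by move=> a _ ->; rewrite scaler0.
- by move=> w [t [q [beta [_ _ rq _ _]]]]; rewrite -rq ltnNge leq_addr in pr.
Qed.

Lemma skew_seq_wider l l' r p :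
  {subset l <= l'} -> skew_seq l r p `<=` skew_seq l' r p.
Proof.
move=> ll'; apply: lspan_ind.
- exact: lspan0.
- by move=> *; exact: lspanD.
- by move=> *; exact: lspanZ.
- move=> _ [t [q [beta [st tl rq qb ->]]]]; apply: lspan_sub.
  by exists t, q, beta; split=> // i /tl /ll'.
Qed.

Lemma skew_seq_gen l l' r p i u : {subset l <= l'} -> i \in l' ->
  skew_seq l r p u -> skew_seq l' r.+1 p.+1 (ext_gen (v i) * u).
Proof.
move=> ll' il'; apply: (lspan_linear (phi := ext_lmul (ext_gen (v i)))).
move=> _ [t [q [beta [st tl rq qb ->]]]]; apply: lspan_sub.
exists (i :: t), q, beta; split=> //=; rewrite ?st ?addSn ?rq //.
  by move=> j; rewrite inE => /orP [/eqP ->|/tl /ll'].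
by rewrite wedge_seq_cons -mulrA.
Qed.

(** The last of the r + 1 factors is absorbed into the cofactor, whose degree grows by one. *)
Lemma skew_seq_le l r p : skew_seq l r.+1 p `<=` skew_seq l r p.
Proof.
apply: lspan_ind.
- exact: lspan0.
- by move=> *; exact: lspanD.
- by move=> *; exact: lspanZ.
- move=> _ [t [q [beta [st tl rq qb ->]]]]; apply: lspan_sub.
  case/lastP: t st tl => // t i; rewrite size_rcons => -[st] til.
  exists t, q.+1, (ext_gen (v i) * beta); split=> //.
  + by move=> j jt; apply: til; rewrite mem_rcons inE jt orbT.
  + by rewrite addnS.
  + exact: ext_pow_gen.
  + by rewrite -cats1 wedge_seq_cat wedge_seq_cons wedge_seq_nil mulr1 mulrA.
Qed.

Lemma contraction_skew_seq (f : {scalar M}) (iota : {linear E -> E}) l r p u :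
  iota 1 = 0 ->
  (forall x w, iota (ext_gen x * w) = f x *: w - ext_gen x * iota w) ->
  (forall i, i \in l -> f (v i) = 0) ->
  skew_seq l r p.+1 u -> skew_seq l r p (iota u).
Proof.
move=> iota1 iotaM fl; have [iota0 iotaS] := contraction_ext_pow iota1 iotaM.
apply: lspan_linear => _ [t [q [beta [st tl rq qb ->]]]].
rewrite (contraction_wedge_seq iotaM) => [|i /tl /fl //].
apply: lspanZ; case: q => [|q] in rq qb *.
  by rewrite iota0 // mulr0; exact: lspan0.
apply: lspan_sub; exists t, q, (iota beta); split=> //; last exact: iotaS.
by move: rq; rewrite addnS => -[].
Qed.

(** Pigeonhole: more factors than indices in [l] force a repetition. This is the source of (B). *)
Lemma skew_seq_kill l r p t u : {subset t <= l} -> (size l < size t + r)%N ->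
  skew_seq l r p u -> wedge_seq v t * u = 0.
Proof.
move=> tl szl; apply: (lspan_ind (P := fun u => wedge_seq v t * u = 0)).
- exact: mulr0.
- by move=> x y x0 y0; rewrite mulrDr x0 y0 addr0.
- by move=> a x x0; rewrite -ext_scalerAr x0 scaler0.
- move=> _ [t' [q [beta [st tl' _ _ ->]]]]; rewrite mulrA -wedge_seq_cat.
  rewrite wedge_seq_dup ?mul0r //; apply/negP => /uniq_leq_size.
  move=> /(_ l) le_l; rewrite ltnNge -st -size_cat le_l // in szl.
  by move=> i; rewrite mem_cat => /orP [/tl|/tl'].
Qed.

End SkewSeq.

End WedgeSeq.

(** * Congruence modulo an ideal, and division after multiplying by a power *)

Section ModuloIdeal.
Variables (R : comPzRingType) (M : lmodType R).
Local Notation E := (exterior M).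

Definition is_ideal (J : set R) : Prop :=
  [/\ J 0, forall x y, J x -> J y -> J (x + y) & forall a x, J x -> J (a * x)].

Definition ideal_add1 (J : set R) (a : R) : set R :=
  [set x | exists j y, J j /\ x = j + a * y].

Lemma ideal_add1_ideal J a : is_ideal J -> is_ideal (ideal_add1 J a).
Proof.
move=> [J0 JD JM]; split.
- by exists 0, 0; rewrite mulr0 addr0.
- move=> _ _ [j [y [Jj ->]]] [j' [y' [Jj' ->]]].
  by exists (j + j'), (y + y'); rewrite mulrDr addrACA; split; first exact: JD.
- move=> b _ [j [y [Jj ->]]]; exists (b * j), (b * y); split; first exact: JM.
  by rewrite mulrDr mulrCA.
Qed.

Lemma ideal_add1_sub J a : J `<=` ideal_add1 J a.
Proof. by move=> j Jj; exists j, 0; rewrite mulr0 addr0. Qed.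

(* For free M this says that [u] has its coordinates in [J]. *)
Definition ext_mod (J : set R) (u : E) : Prop := forall lambda : {scalar E}, J (lambda u).

Section Ideal.
Variables (J : set R) (idealJ : is_ideal J).

Lemma ext_mod0 : ext_mod J 0.
Proof. by case: idealJ => J0 _ _ lambda; rewrite linear0. Qed.

Lemma ext_modD u w : ext_mod J u -> ext_mod J w -> ext_mod J (u + w).
Proof. by case: idealJ => _ JD _ Ju Jw lambda; rewrite linearD; apply: JD. Qed.

Lemma ext_modZ a u : ext_mod J u -> ext_mod J (a *: u).
Proof. by case: idealJ => _ _ JM Ju lambda; rewrite scalarZ; apply: JM. Qed.

Lemma ext_modN u : ext_mod J u -> ext_mod J (- u).
Proof. by rewrite -scaleN1r; exact: ext_modZ. Qed.

Lemma ext_mod_sum (I : Type) (t : seq I) (P : pred I) (F : I -> E) :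
  (forall i, P i -> ext_mod J (F i)) -> ext_mod J (\sum_(i <- t | P i) F i).
Proof. by move=> JF; apply: big_ind => //; [exact: ext_mod0|exact: ext_modD]. Qed.

(** Precomposing a functional with [phi] gives a functional again: the benefit of testing against
    all of them. *)
Lemma ext_mod_linear (phi : {linear E -> E}) u : ext_mod J u -> ext_mod J (phi u).
Proof. by move=> Ju lambda; exact: (Ju (lambda \o phi)). Qed.

Lemma ext_mod_mul w u : ext_mod J u -> ext_mod J (w * u).
Proof. exact: (ext_mod_linear (ext_lmul w)). Qed.

Lemma ext_mod_sign n u : ext_mod J ((-1) ^+ n *: u) -> ext_mod J u.
Proof. by move/(ext_modZ ((-1) ^+ n)); rewrite scalerA -expr2 sqrr_sign scale1r. Qed.

Lemma ext_mod_nzd a u :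
  (forall x, J (a * x) -> J x) -> ext_mod J (a *: u) -> ext_mod J u.
Proof. by move=> nzd Jau lambda; apply: nzd; rewrite -scalarZ. Qed.

(* Contracting by the form dual to the first vector [v i] splits
   a eta = v_i /\ iota eta + iota (v_i /\ eta), and both summands satisfy the
   hypothesis for the remaining vectors, with r - 1, s and r, s - 1. *)
Lemma skew_seq_expr (I : eqType) (v : I -> M) (f : I -> {scalar M}) (a : R)
    (l : seq I) (r s p : nat) (eta : E) :
  uniq l ->
  {in l &, forall i j, f i (v j) = if i == j then a else 0} ->
  (r + s = size l + 1)%N -> ext_pow M p eta ->
  (forall t, size t = s -> {subset t <= l} -> ext_mod J (wedge_seq v t * eta)) ->
  exists u, skew_seq v l r p u /\ ext_mod J (a ^+ size l *: eta - u).
Proof.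
have skew_self l' p' w n : ext_pow M p' w ->
    exists u, skew_seq v l' 0 p' u /\ ext_mod J (a ^+ n *: w - u).
  exists (a ^+ n *: w); split; first exact/skew_seq0/lspanZ.
  by rewrite subrr; exact: ext_mod0.
(* For r = 0 the multiple of eta is its own witness; the induction on [l] treats positive r. *)
case: r => [_ _ _ peta _|r]; first exact: skew_self.
elim: l r s p eta => [|i l IHl] r s p eta.
  (* On the empty list the count forces s = 0, and (B) for the empty product says that eta is 0
     modulo J. *)
  case: s => [|s]; last by rewrite addnS addSn => _ _ [].
  move=> _ _ _ _ /(_ [::] erefl) Jeta; exists 0; split; first exact: lspan0.
  by rewrite subr0 scale1r -[eta]mul1r -(wedge_seq_nil v); apply: Jeta.
case: s => [|s] /=.
  move=> _ _ _ _ /(_ [::] erefl) Jeta; exists 0; split; first exact: lspan0.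
  by rewrite subr0; apply: ext_modZ; rewrite -[eta]mul1r -(wedge_seq_nil v); apply: Jeta.
move=> /andP [il ul] fv rs peta Jeta.
have sub_l : {subset l <= i :: l} by move=> j jl; rewrite inE jl orbT.
have fl : {in l &, forall i j, f i (v j) = if i == j then a else 0}.
  by move=> j j' jl j'l; apply: fv; exact: sub_l.
have fi j : j \in l -> f i (v j) = 0.
  move=> jl; rewrite fv ?mem_head ?sub_l //.
  by case: eqVneq => // ij; rewrite ij jl in il.
have [iota [iota1 iotaM]] := contraction_exists (f i).
have [iota0 iotaS] := contraction_ext_pow iota1 iotaM.
have IH' r' s' p' w : (r' + s' = size l + 1)%N -> ext_pow M p' w ->
    (forall t, size t = s' -> {subset t <= l} -> ext_mod J (wedge_seq v t * w)) ->
    exists u, skew_seq v l r' p' u /\ ext_mod J (a ^+ size l *: w - u).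
  by case: r' => [_ pw _|r']; [exact: skew_self|exact: IHl].
have [u1 [su1 Ju1]] : exists u, skew_seq v (i :: l) r.+1 p u /\
    ext_mod J (a ^+ size l *: (ext_gen (v i) * iota eta) - u).
  case: p => [|p] in peta *.
    exists 0; split; first exact: lspan0.
    by rewrite iota0 // mulr0 scaler0 subr0; exact: ext_mod0.
  have [] := IH' r s.+1 p (iota eta).
  - by move: rs; rewrite addSn addSn => -[].
  - exact: iotaS.
  (* (B) for [iota eta]: f_i vanishes on the remaining vectors, so contracting the product with eta
     reaches only eta, up to sign. *)
  - move=> t st tl; have := Jeta t st (fun j jt => sub_l j (tl j jt)).
    move/(ext_mod_linear iota); rewrite (contraction_wedge_seq iotaM).
      exact: ext_mod_sign.
    by move=> j /tl /fi.
  move=> u [su Ju]; exists (ext_gen (v i) * u); split.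
    by apply: skew_seq_gen su => //; exact: mem_head.
  by rewrite ext_scalerAr -mulrBr; exact: ext_mod_mul.
have [u2 [su2 Ju2]] : exists u, skew_seq v (i :: l) r.+1 p u /\
    ext_mod J (a ^+ size l *: iota (ext_gen (v i) * eta) - u).
  have [] := IH' r.+1 s p.+1 (ext_gen (v i) * eta).
  - by move: rs; rewrite addnS addSn => -[].
  - exact: ext_pow_gen.
  (* (B) for v_i /\ eta with one vector fewer: v_i itself supplies the missing one. *)
  - move=> t st tl; have := Jeta (t ++ [:: i]).
    rewrite wedge_seq_cat wedge_seq_cons wedge_seq_nil mulr1 mulrA; apply.
      by rewrite size_cat st addn1.
    by move=> j; rewrite mem_cat !inE => /orP [/tl ->|->]; rewrite ?orbT.
  move=> u [su Ju]; exists (iota u); split.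
    by apply: skew_seq_wider sub_l _ _; exact: contraction_skew_seq su.
  by rewrite -linearZ -linearB; exact: ext_mod_linear.
exists (u1 + u2); split; first exact: lspanD.
suff -> : a ^+ (size l).+1 *: eta - (u1 + u2) =
    (a ^+ size l *: (ext_gen (v i) * iota eta) - u1) +
    (a ^+ size l *: iota (ext_gen (v i) * eta) - u2) by exact: ext_modD.
rewrite addrACA -opprD -scalerDr; congr (_ - _); rewrite iotaM addrC subrK.
by rewrite fv ?mem_head // eqxx scalerA -exprSr.
Qed.

End Ideal.
End ModuloIdeal.

(** * Regular sequences relative to an ideal *)

Section WeaklyRegular.
Variable R : comPzRingType.

(** The non-zero-divisor conditions relative to J, in recursive form so that the descent can consume
    the head and enlarge J. *)
Fixpoint weakly_regular (J : set R) (l : seq R) : Prop :=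
  if l is a :: l' then
    (forall x, J (a * x) -> J x) /\ weakly_regular (ideal_add1 J a) l'
  else True.

Lemma weakly_regular_ext (J J' : set R) l :
  (forall x, J x <-> J' x) -> weakly_regular J l -> weakly_regular J' l.
Proof. by move=> JJ'; have -> : J' = J by apply/seteqP; split=> x /JJ'. Qed.

Lemma ideal_add1C (J : set R) a b x :
  ideal_add1 (ideal_add1 J a) b x <-> ideal_add1 (ideal_add1 J b) a x.
Proof.
suff C c d : ideal_add1 (ideal_add1 J c) d x -> ideal_add1 (ideal_add1 J d) c x.
  by split; exact: C.
move=> [_ [y [[j [z [Jj ->]]] ->]]]; exists (j + d * y), z.
by split; [exists j, y|rewrite addrAC].
Qed.

(** Induction on [l] with J replaced by J + (b), b being the head. Regular sequences need not be
    permutable, but a does remain a non-zero-divisor modulo J + (b), and that is what the induction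
    asks for. *)
Lemma weakly_regular_expr (J : set R) a l n : is_ideal J ->
  (forall x, J (a * x) -> J x) -> weakly_regular (ideal_add1 J a) l ->
  weakly_regular (ideal_add1 J (a ^+ n.+1)) l.
Proof.
elim: l J => // b l IHl J idealJ nzd_a /= [nzd_b reg]; split.
  case: (idealJ) => J0 JD JM.
  (* Raise the exponent by one: x = j' + a^(n'+1) z by induction; cancelling a^(n'+1) puts b z in J
     + (a), hence z too, which gives one more factor a. *)
  elim: (n) => [|n' IHn] x; first by rewrite expr1; exact: nzd_b.
  move=> [j [y [Jj bx]]].
  have [|j' [z [Jj' xE]]] := IHn x.
    by exists j, (a * y); rewrite bx exprSr mulrA.
  have : ideal_add1 J a (b * z).
    exists (b * z - a * y), y; split; last by rewrite subrK.
    suff /(_ n'.+1) : forall i, J (a ^+ i * (b * z - a * y)) -> J (b * z - a * y).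
      apply; suff -> : a ^+ n'.+1 * (b * z - a * y) = j - b * j'.
        by apply: JD => //; rewrite -mulN1r mulrA; exact: JM.
      rewrite mulrBr mulrCA -[_ * z](addKr j') -xE mulrDr bx mulrN.
      by rewrite (mulrA _ a) -exprSr addrA addrK addrC.
    by elim=> [|i IHi]; rewrite ?mul1r // exprS -mulrA => /nzd_a.
  case/nzd_b => j'' [w [Jj'' zE]]; exists (j' + a ^+ n'.+1 * j''), w; split.
    by apply: JD => //; exact: JM.
  by rewrite xE zE mulrDr addrA mulrA -exprSr.
apply: (weakly_regular_ext (fun x => ideal_add1C J b (a ^+ n.+1) x)).
apply: IHl; first exact: ideal_add1_ideal.
  (* From a x = j + b y one gets y = j' + a z, as b is regular modulo J + (a); then a (x - b z) = j
     + b j' lies in J. *)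
  move=> x [j [y [Jj ax]]].
  have [|j' [z [Jj' yE]]] := nzd_b y.
    exists (- j), x; split; last by rewrite ax addKr.
    by case: idealJ => _ _ JM; rewrite -mulN1r; exact: JM.
  exists (x - b * z), z; split; last by rewrite subrK.
  apply: nzd_a; case: idealJ => _ JD JM.
  suff -> : a * (x - b * z) = j + b * j' by apply: JD => //; exact: JM.
  by rewrite mulrBr ax yE mulrDr addrA (mulrCA a b z) addrK.
by apply: weakly_regular_ext reg => x; exact: ideal_add1C.
Qed.

Lemma regular_seq_weakly_regular (l : seq R) :
  regular_seq l -> weakly_regular [set 0] l.
Proof.
move=> [_ reg].
(* The prefix already consumed becomes the ideal; the empty prefix generates 0. *)
suff wr t u : l = t ++ u -> weakly_regular (ideal_gen [set` t]) u.
  have := wr [::] l erefl; apply: weakly_regular_ext => x.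
  split=> [|->]; last exact: lspan0.
  by move=> [n [c [w [w0 ->]]]]; apply: big1 => i; have := w0 i.
elim: u t => //= a u IHu t lE; split.
  have := reg (size t); rewrite lE take_size_cat // nth_cat ltnn subnn size_cat /=.
  by apply; rewrite addnS ltnS leq_addr.
have := IHu (rcons t a); rewrite cat_rcons => /(_ lE).
apply: weakly_regular_ext => x; split.
  apply: (@lspan_ind _ R^o [set` rcons t a] (ideal_add1 (ideal_gen [set` t]) a)).
  - by exists 0, 0; split; [exact: lspan0|rewrite mulr0 addr0].
  - move=> _ _ [j [y [Jj ->]]] [j' [y' [Jj' ->]]].
    by exists (j + j'), (y + y'); rewrite mulrDr addrACA; split; first exact: lspanD.
  - move=> b _ [j [y [Jj ->]]]; exists (b * j), (b * y); split; last first.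
      by rewrite mulrCA -mulrDr.
    exact: (@lspanZ _ R^o).
  - move=> y /=; rewrite mem_rcons inE => /orP [/eqP ->|yt].
      by exists 0, 1; split; [exact: lspan0|rewrite mulr1 add0r].
    by exists y, 0; split; [exact: lspan_sub|rewrite mulr0 addr0].
move=> [j [y [Jj ->]]]; apply: lspanD.
  apply: (@lspan_ind _ R^o [set` t] (ideal_gen [set` rcons t a])) Jj.
  - exact: lspan0.
  - by move=> *; exact: lspanD.
  - by move=> *; exact: (@lspanZ _ R^o).
  - by move=> z zt; apply: lspan_sub => /=; rewrite mem_rcons inE zt orbT.
rewrite mulrC; apply: (@lspanZ _ R^o).
by apply: lspan_sub => /=; rewrite mem_rcons mem_head.
Qed.

End WeaklyRegular.

(** * Skew-tensor products over a finite generating family *)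

Section FiniteFamily.
Variables (R : comPzRingType) (M : lmodType R) (n : nat) (v : 'I_n -> M).
Local Notation E := (exterior M).
Local Notation N := (lspan (range v)).

(** Multilinear expansion of the factors in the generators, one factor at a time. *)
Lemma wedge_mul_skew_seq r q (w : 'I_r -> M) (beta : E) :
  (forall j, N (w j)) -> ext_pow M q beta ->
  skew_seq v (enum 'I_n) r (r + q) (wedge w * beta).
Proof.
move=> Nw qb; elim: r w Nw => [|r IHr] w Nw.
  by rewrite [wedge w]big_ord0 mul1r; exact: skew_seq0.
rewrite wedge_recl -mulrA; set u := _ * beta.
have su : skew_seq v (enum 'I_n) r (r + q) u by apply: IHr => j; exact: Nw.
apply: (lspan_ind _ _ _ _ (Nw ord0) (P := fun x =>
  skew_seq v (enum 'I_n) r.+1 (r.+1 + q) (ext_gen x * u))) => [|x y sx sy|a x sx|].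
- by rewrite linear0 mul0r; exact: lspan0.
- by rewrite linearD mulrDl; exact: lspanD.
- by rewrite linearZ /= -(ext_scalerAl a); exact: lspanZ.
- by move=> _ [i _ <-]; apply: skew_seq_gen su => //; rewrite mem_enum.
Qed.

Lemma skew_tensor_skew_seq r q : skew_tensor N r q `<=` skew_seq v (enum 'I_n) r (r + q).
Proof.
move=> _ [k [alpha [beta [aN bq ->]]]]; apply: lspan_sum => i _.
by have [w Nw ->] := aN i; exact: wedge_mul_skew_seq.
Qed.

Lemma skew_seq_skew_tensor r q : skew_seq v (enum 'I_n) r (r + q) `<=` skew_tensor N r q.
Proof.
move=> _ [k [c [u [su ->]]]].
have /choice [ab abP] i : exists ab : E * E,
    [/\ exists2 w : 'I_r -> M, (forall j, N (w j)) & ab.1 = wedge w,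
        ext_pow M q ab.2 & u i = ab.1 * ab.2].
  have [t [q' [beta [st _ /addnI <- qb ->]]]] := su i.
  exists (wedge_seq v t, beta); split=> //.
  have st' : size t == r by rewrite st.
  exists (fun j => v (tnth (Tuple st') j)) => [j|]; first exact/lspan_sub/imageP.
  exact: (wedge_seq_tuple v (Tuple st')).
exists k, (fun i => (ab i).1), (fun i => c i *: (ab i).2); split.
- by move=> i; case: (abP i).
- by move=> i; apply: lspanZ; case: (abP i).
- by apply: eq_bigr => i _; rewrite -ext_scalerAr; case: (abP i) => _ _ <-.
Qed.

(** Products with a repeated index vanish, the others are sorted up to sign; this collects one
    coefficient per r-subset. *)
Lemma skew_seq_sets r q u : skew_seq v (enum 'I_n) r (r + q) u ->
  exists xi : {set 'I_n} -> E, (forall A, ext_pow M q (xi A)) /\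
    u = \sum_(A : {set 'I_n} | #|A| == r) wedge_seq v (enum A) * xi A.
Proof.
apply: (lspan_ind (P := fun u => exists xi : {set 'I_n} -> E,
    (forall A, ext_pow M q (xi A)) /\
    u = \sum_(A : {set 'I_n} | #|A| == r) wedge_seq v (enum A) * xi A)).
- exists (fun=> 0); split=> [A|]; first exact: lspan0.
  by rewrite big1 // => A _; rewrite mulr0.
- move=> _ _ [xi [qxi ->]] [xi' [qxi' ->]]; exists (fun A => xi A + xi' A).
  split=> [A|]; first by apply: lspanD; [exact: qxi|exact: qxi'].
  by rewrite -big_split; apply: eq_bigr => A _; rewrite mulrDr.
- move=> a _ [xi [qxi ->]]; exists (fun A => a *: xi A).
  split=> [A|]; first exact/lspanZ/qxi.
  by rewrite scaler_sumr; apply: eq_bigr => A _; rewrite ext_scalerAr.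
- move=> _ [t [q' [beta [st _ /addnI -> qb ->]]]].
  have [ut|/wedge_seq_dup ->] := boolP (uniq t); last first.
    exists (fun=> 0); split=> [A|]; first exact: lspan0.
    by rewrite mul0r big1 // => A _; rewrite mulr0.
  have /(wedge_seq_perm v) [d ->] : perm_eq t (enum [set i in t]).
    by apply: uniq_perm; rewrite ?enum_uniq // => i; rewrite mem_enum inE.
  exists (fun A => if A == [set i in t] then (-1) ^+ d *: beta else 0); split.
    by move=> A; case: ifP => _; [exact: lspanZ|exact: lspan0].
  rewrite (bigD1 [set i in t]) /=; last by rewrite cardsE (card_uniqP ut) st.
  rewrite eqxx big1 ?addr0 => [|A /andP [_ /negPf ->]]; last exact: mulr0.
  by rewrite -(ext_scalerAl (_ ^+ d)) (ext_scalerAr (_ ^+ d)).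
Qed.

(** A set B other than A, of the same size, meets the complement of A. Multiplying by that
    complement therefore isolates the coefficient at A. *)
Lemma wedge_seq_setC_mul (A B : {set 'I_n}) : #|A| = #|B| ->
  exists d, wedge_seq v (enum (~: A)) * wedge_seq v (enum B) =
    if A == B then (-1) ^+ d *: wedge v else 0.
Proof.
move=> AB; rewrite -wedge_seq_cat; case: eqVneq => [<-|neqAB].
  have /(wedge_seq_perm v) [d ->] : perm_eq (enum (~: A) ++ enum A) (enum 'I_n).
    apply: uniq_perm; rewrite ?enum_uniq // ?cat_uniq ?enum_uniq /= ?andbT.
      by apply/hasPn => i; rewrite !mem_enum inE negbK.
    by move=> i; rewrite mem_cat !mem_enum inE orNb.
  by exists d; rewrite wedge_enum.
exists 0%N; apply: wedge_seq_dup; rewrite cat_uniq !enum_uniq /= andbT negbK.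
have /subsetPn [i iB iA] : ~~ (B \subset A).
  by apply: contra neqAB => BA; rewrite eq_sym eqEcard BA AB leqnn.
by apply/hasP; exists i; rewrite !mem_enum ?inE.
Qed.

Lemma basis_wedgeE (A : {set 'I_n}) : basis_wedge v A = wedge_seq v (enum A).
Proof. by rewrite /basis_wedge -big_filter [index_enum _]unlock. Qed.

End FiniteFamily.

(** * Coordinates on the exterior algebra of a free module *)

Section Basis.
Variables (R : comPzRingType) (M : lmodType R) (m : nat) (e : 'I_m -> M).
Hypothesis basis_e : is_basis setT e.
Local Notation E := (exterior M).

Lemma coordinates_exist : exists f : 'I_m -> {scalar M},
  forall i j, f i (e j) = (i == j)%:R.
Proof.
have [eT indep] := basis_e.
have /choice [c cE] x : exists c : 'I_m -> R, x = \sum_i c i *: e i.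
  have : lspan (range e) x by rewrite -eT.
  apply: (lspan_ind (P := fun x => exists c : 'I_m -> R, x = \sum_i c i *: e i)).
  - by exists (fun=> 0); rewrite big1 // => i _; rewrite scale0r.
  - move=> _ _ [c ->] [d ->]; exists (fun i => c i + d i).
    by rewrite -big_split; apply: eq_bigr => i _; rewrite scalerDl.
  - move=> a _ [c ->]; exists (fun i => a * c i).
    by rewrite scaler_sumr; apply: eq_bigr => i _; rewrite scalerA.
  - move=> _ [j _ <-]; exists (fun i => (i == j)%:R).
    rewrite (bigD1 j) //= eqxx scale1r big1 ?addr0 // => i /negPf ->.
    by rewrite scale0r.
have c_uniq d x : x = \sum_i d i *: e i -> c x = d.
  move=> dE; apply/funext => i; apply/eqP; rewrite -subr_eq0; apply/eqP.
  apply: (indep (fun i => c x i - d i)).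
  under eq_bigr do rewrite scalerBl.
  by rewrite sumrB -cE -dE subrr.
have c_lin i : scalar (fun x => c x i).
  move=> a x y; rewrite (c_uniq (fun i => a * c x i + c y i)) //.
  under eq_bigr do rewrite scalerDl -scalerA.
  by rewrite big_split -scaler_sumr -!cE.
pose f i : {scalar M} := HB.pack (fun x => c x i)
  (GRing.isLinear.Build R M R *%R (fun x => c x i) (c_lin i)).
exists f => i j; rewrite /= (c_uniq (fun i => (i == j)%:R)) //.
rewrite (bigD1 j) //= eqxx scale1r big1 ?addr0 // => k /negPf ->.
by rewrite scale0r.
Qed.

(** The functional is the augmentation after successive contractions by the coordinate forms of the
    elements of S. *)
Lemma ext_coordinate_exists (S : {set 'I_m}) : exists lambda : {scalar E},
  forall T : {set 'I_m}, lambda (wedge_seq e (enum T)) = (S == T)%:R.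
Proof.
have [f fE] := coordinates_exist.
(* The vanishing clause is the invariant: contracting e_j /\ w leaves w - e_j /\ iota w, and
   [lambda] kills the second term. *)
suff {S} dual (P : pred 'I_m) (l : seq 'I_m) : uniq l -> exists lambda : {scalar E},
    (forall j u, (j \notin l) || ~~ P j -> lambda (ext_gen (e j) * u) = 0) /\
    forall Q : pred 'I_m, lambda (wedge_seq e (filter Q l)) =
      (all (fun i => P i == Q i) l)%:R.
  have [lambda [_ lambdaE]] := dual (mem S) (enum 'I_m) (enum_uniq _).
  exists lambda => T; rewrite {1}/enum_mem -enumT lambdaE; congr ((nat_of_bool _)%:R).
  apply/allP/eqP => [ST|-> i _]; last by [].
  by apply/setP => i; apply/eqP/ST; rewrite mem_enum.
elim: l => [_|j l IHl /= /andP [jl /IHl [lambda [lambda0 lambdaE]]]].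
  have [eps [eps1 eps0]] := augmentation_exists M.
  by exists eps; split=> // Q; rewrite wedge_seq_nil eps1.
have [Pj|nPj] := boolP (P j); last first.
  exists lambda; split=> [i u|Q].
    rewrite inE negb_or => /orP [/andP [_ il]|nPi]; first by rewrite lambda0 ?il.
    by rewrite lambda0 ?nPi ?orbT.
  case: ifP => Qj /=; last exact: lambdaE.
  by rewrite wedge_seq_cons lambda0 ?nPj ?orbT.
have [iota [iota1 iotaM]] := contraction_exists (f j).
exists (lambda \o iota); split=> [i u|Q] /=.
  move=> ilP; have ij : j != i.
    by apply: contraTneq ilP => <-; rewrite mem_head Pj.
  rewrite iotaM fE (negPf ij) scale0r sub0r linearN lambda0 ?oppr0 //.
  by move: ilP; rewrite inE negb_or eq_sym ij.
case: ifP => Qj /=.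
  by rewrite wedge_seq_cons iotaM fE eqxx scale1r linearB lambda0 ?jl // subr0.
rewrite -[wedge_seq _ _]mulr1 (contraction_wedge_seq iotaM) => [|i].
  by rewrite iota1 mulr0 scaler0 linear0.
rewrite mem_filter => /andP [_ il]; rewrite fE.
by case: eqVneq => // ji; rewrite ji il in jl.
Qed.

Lemma ext_coordinates : exists kappa : {set 'I_m} -> {scalar E},
  (forall S T : {set 'I_m}, kappa S (wedge_seq e (enum T)) = (S == T)%:R) /\
  forall p u, ext_pow M p u ->
    u = \sum_(S : {set 'I_m} | #|S| == p) kappa S u *: wedge_seq e (enum S).
Proof.
have [kappa kappaE] := choice ext_coordinate_exists.
exists kappa; split=> // p u pu.
(* With p factors e_i the cofactors have degree 0, so they are scalars. *)
have : skew_seq e (enum 'I_m) p (p + 0) u.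
  move: pu; apply: lspan_ind => [|||_ [w _ <-]].
  - exact: lspan0.
  - by move=> *; exact: lspanD.
  - by move=> *; exact: lspanZ.
  - rewrite -[wedge w]mulr1; apply: wedge_mul_skew_seq; last exact: ext_pow1.
    by move=> j; case: basis_e => <-.
case/skew_seq_sets => xi [xi0 uE].
have /choice [c cE] S := ext_pow0 (xi0 S).
have {}uE : u = \sum_(S : {set 'I_m} | #|S| == p) c S *: wedge_seq e (enum S).
  by rewrite uE; apply: eq_bigr => S _; rewrite cE -ext_scalerAr mulr1.
rewrite {1}uE; apply: eq_bigr => S pS; congr (_ *: _).
rewrite uE linear_sum (bigD1 S) //= scalarZ kappaE eqxx mulr1.
rewrite big1 ?addr0 // => T /andP [_ TS].
by rewrite scalarZ kappaE eq_sym (negPf TS) mulr0.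
Qed.

Lemma ext_mod_zero p (u : E) : ext_pow M p u -> ext_mod [set 0] u -> u = 0.
Proof.
have [kappa [_ kappaP]] := ext_coordinates.
by move=> pu u0; rewrite (kappaP p u pu) big1 // => S _; rewrite u0 scale0r.
Qed.

Lemma ext_pow_lreg p a (u : E) :
  GRing.lreg a -> ext_pow M p u -> a *: u = 0 -> u = 0.
Proof.
move=> rega pu au0; apply: (ext_mod_zero pu) => lambda.
by apply: rega; rewrite mulr0 -scalarZ au0 linear0.
Qed.

(** The decomposition j + a y is chosen coordinate by coordinate, then reassembled over the basis of
    the exterior power. *)
Lemma ext_mod_split (J : set R) a q (u : E) : is_ideal J -> ext_pow M q u ->
  ext_mod (ideal_add1 J a) u ->
  exists w, ext_pow M q w /\ ext_mod J (u - a *: w).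
Proof.
move=> [J0 JD JM] qu Ju; have [kappa [_ kappaP]] := ext_coordinates.
have /choice [jy jyP] (S : {set 'I_m}) : exists jy : R * R,
    J jy.1 /\ kappa S u = jy.1 + a * jy.2.
  by have [j [y [Jj uE]]] := Ju (kappa S); exists (j, y).
exists (\sum_(S : {set 'I_m} | #|S| == q) (jy S).2 *: wedge_seq e (enum S)).
split.
  apply: lspan_sum => S /eqP qS; apply: lspanZ.
  rewrite -(mulr1 (wedge_seq _ _)) -(addn0 q) -qS cardE.
  exact/ext_pow_wedge_seq/ext_pow1.
rewrite [u in u - _](kappaP q) // scaler_sumr -sumrB.
apply: ext_mod_sum => // S _ lambda; rewrite scalerA -scalerBl scalarZ mulrC.
by apply: JM; rewrite (jyP S).2 addrK; case: (jyP S).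
Qed.

(* The forms are f_i x = +-lambda (x /\ omega_0 /\ .. omega_i omitted ..), where
   the functional lambda takes the value [a] on omega_0 /\ .. /\ omega_(k-1). *)
Lemma coef_ideal_forms k (omega : 'I_k -> M) a : coef_ideal e omega a ->
  exists f : 'I_k -> {scalar M}, forall i j, f i (omega j) = if i == j then a else 0.
Proof.
have [kappa [kappaE _]] := ext_coordinates.
move=> [c [omegaE]].
have kappa_omega (S : {set 'I_m}) : #|S| = k -> kappa S (wedge omega) = c S.
  move=> /eqP kS; rewrite omegaE linear_sum (bigD1 S) //= scalarZ.
  rewrite basis_wedgeE kappaE eqxx mulr1 big1 ?addr0 // => T /andP [_ TS].
  by rewrite scalarZ basis_wedgeE kappaE eq_sym (negPf TS) mulr0.
(* The coefficients are values of coordinate functionals on Omega; functionals add and scale, so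
   every element of the ideal is such a value. *)
have aI : forall a, ideal_gen [set c S | S in [set S : {set 'I_m} | #|S| = k]] a ->
    exists lambda : {scalar E}, lambda (wedge omega) = a.
  apply: (@lspan_ind _ R^o _ (fun a => exists lambda : {scalar E}, lambda (wedge omega) = a)).
  - by exists \0; rewrite /=.
  - by move=> _ _ [l <-] [l' <-]; exists (l \+ l').
  - move=> b _ [l <-].
    have bl : scalar (fun u => b * l u).
      by move=> d u w; rewrite linearP mulrDr mulrCA.
    pose bL : {scalar E} := HB.pack (fun u => b * l u)
      (GRing.isLinear.Build R E R *%R (fun u => b * l u) bl).
    by exists bL.
  - by move=> _ [S kS <-]; exists (kappa S); exact: kappa_omega.
move=> /aI [lambda lambdaE].
have form i : exists f : {scalar M}, forall j, f (omega j) = if i == j then a else 0.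
  have [d wd] := wedge_seq_rem omega (mem_enum 'I_k i : i \in enum 'I_k).
  rewrite -wedge_enum wedge_seq_cons in wd.
  set W := wedge_seq _ (rem i _) in wd.
  pose f0 x := lambda (((-1) ^+ d *: ext_gen x) * W).
  have f0lin : scalar f0.
    move=> b x y; rewrite /f0 linearP scalerDr mulrDl linearD; congr (_ + _).
    by rewrite scalerA mulrC -scalerA -(ext_scalerAl b) scalarZ.
  pose f : {scalar M} := HB.pack f0 (GRing.isLinear.Build R M R *%R f0 f0lin).
  exists f => j.
  rewrite /= /f0 -(ext_scalerAl (_ ^+ d)).
  case: eqVneq => [<-|ij]; first by rewrite -wd.
  rewrite /W -wedge_seq_cons wedge_seq_dup ?scaler0 ?linear0 //=.
  by rewrite mem_rem_uniq ?enum_uniq // inE eq_sym ij mem_enum.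
by have [f fE] := choice form; exists f.
Qed.

End Basis.

(** * Division along a regular sequence *)

Section Division.
Variables (R : comPzRingType) (M : lmodType R) (m : nat) (e : 'I_m -> M).
Hypothesis basis_e : is_basis setT e.
Variables (k : nat) (omega : 'I_k -> M).
Local Notation E := (exterior M).
Local Notation skew := (skew_seq omega (enum 'I_k)).

(** The shape in which membership of a in I(N) enters the division arguments. *)
Definition dual_forms (a : R) : Prop :=
  exists f : 'I_k -> {scalar M}, forall i j, f i (omega j) = if i == j then a else 0.

Lemma skew_expr (J : set R) a r s p (eta : E) : is_ideal J -> dual_forms a ->
  (r + s = k + 1)%N -> ext_pow M p eta ->
  (forall t, size t = s -> ext_mod J (wedge_seq omega t * eta)) ->
  exists u, skew r p u /\ ext_mod J (a ^+ k *: eta - u).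
Proof.
move=> idealJ [f fE] rs peta Jeta.
have := @skew_seq_expr _ _ J idealJ _ omega f a (enum 'I_k) r s p eta.
rewrite size_enum_ord; apply=> //; first exact: enum_uniq.
by move=> t st _; exact: Jeta.
Qed.

(** Among k indices one is repeated, or they permute all of them; so for s = k condition (B) is
    about Omega alone. *)
Lemma ext_mod_top (J : set R) (eta : E) t : is_ideal J -> size t = k ->
  ext_mod J (wedge omega * eta) -> ext_mod J (wedge_seq omega t * eta).
Proof.
move=> idealJ tk Jeta; have [ut|/wedge_seq_dup ->] := boolP (uniq t); last first.
  by rewrite mul0r; exact: ext_mod0.
have te : perm_eq t (enum 'I_k).
  have [] := uniq_min_size (s2 := enum 'I_k) ut.
  - by move=> i _; rewrite mem_enum.
  - by rewrite size_enum_ord tk.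
  - by move=> _ te; apply: uniq_perm; rewrite ?enum_uniq.
have [n ->] := wedge_seq_perm omega te.
by rewrite -wedge_enum -(ext_scalerAl (_ ^+ n)); exact: ext_modZ.
Qed.

(* Downward along the regular sequence: modulo J + (a^k), the coefficients xi of
   a^k eta in \Lambda^r N /\ \Lambda^(p - r) M satisfy Omega /\ xi = 0, which is
   the case r = 1 in degree p - r.  Subtracting the resulting multiple of a^k
   from eta moves a^k eta into \Lambda^(r + 1) N /\ \Lambda^(p - r - 1) M.
   The induction starts at p = r - 1, where the claim reads eta = 0 modulo J. *)
Lemma skew_of_weakly_regular D (J : set R) l r s p (eta : E) :
  is_ideal J -> weakly_regular J l -> (forall a, a \in l -> dual_forms a) ->
  (D < size l)%N -> (r + s = k + 1)%N -> (p + 1 = r + D)%N -> ext_pow M p eta ->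
  (forall t, size t = s -> ext_mod J (wedge_seq omega t * eta)) ->
  exists u, skew r p u /\ ext_mod J (eta - u).
Proof.
(* An empty sequence contradicts the length bound; r = 0 is trivial; for s = 0 the empty product in
   (B) gives eta = 0 modulo J. *)
elim: D J l r s p eta => [|D IHD] J [|a l] [|r] [|s] p eta //= idealJ;
  move=> [nzd_a reg] forms szl rs pr peta Jeta;
  try by [exists eta; split; [exact: skew_seq0|rewrite subrr; exact: ext_mod0]];
  try by [exists 0; split; [exact: lspan0|rewrite subr0 -[eta]mul1r
    -(wedge_seq_nil omega); exact: Jeta]].
all: have nzd_an n x : J (a ^+ n * x) -> J x
  by elim: n => [|n IHn]; rewrite ?mul1r // exprS -mulrA => /nzd_a.
all: have [u [su Ju]] := skew_expr idealJ (forms a (mem_head a l)) rs peta Jeta.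
  (* D = 0: the degree is one less than the number of factors, so [u] is 0 and a^k cancels. *)
  exists 0; split; first exact: lspan0.
  rewrite subr0; apply: (ext_mod_nzd (nzd_an k)).
  rewrite -[_ *: _]subr0 -(skew_seq_degenerate _ su) //.
  by rewrite -[p.+1]addn1 pr addn0.
have {pr} pE : p = (r.+1 + D)%N by move: pr; rewrite addn1 addnS => -[].
have k_gt0 : (0 < k)%N by move: rs; rewrite addn1 addnS addSn => -[<-].
have [xi [Dxi uE]] : exists xi : {set 'I_k} -> E, (forall A, ext_pow M D (xi A)) /\
    u = \sum_(A : {set 'I_k} | #|A| == r.+1) wedge_seq omega (enum A) * xi A.
  by apply: skew_seq_sets; rewrite -pE.
pose J' := ideal_add1 J (a ^+ k).
have idealJ' : is_ideal J' by exact: ideal_add1_ideal.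
have JJ' (w : E) : ext_mod J w -> ext_mod J' w.
  by move=> Jw lambda; exact/ideal_add1_sub/Jw.
have J'a (w : E) : ext_mod J' (a ^+ k *: w).
  by move=> lambda; exists 0, (lambda w); rewrite add0r scalarZ; split=> //; case: idealJ.
have J'u : ext_mod J' u.
  rewrite -[u](subKr (a ^+ k *: eta)); apply: ext_modD => //.
  by apply: ext_modN => //; exact: JJ'.
have reg' : weakly_regular J' l by rewrite /J' -(prednK k_gt0); exact: weakly_regular_expr.
(* The pair (z, w) satisfies xi_A = z + a^k w modulo J; off the sets of size r + 1 it is the default
   (0, 0). *)
have /choice [y yP] (A : {set 'I_k}) : exists y : E * E, #|A| = r.+1 ->
    [/\ skew 1 D y.1, ext_pow M D y.2 & ext_mod J (xi A - y.1 - a ^+ k *: y.2)].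
  have [Ar|nAr] := pselect (#|A| = r.+1); last by exists (0, 0).
  have forms' b : b \in l -> dual_forms b.
    by move=> bl; apply: forms; rewrite inE bl orbT.
  have [t tk|z [sz J'z]] := IHD J' l 1%N k D (xi A) idealJ' reg' forms' szl
    (addnC _ _) (addnC _ _) (Dxi A).
    apply: ext_mod_top => //.
    have := ext_mod_mul (wedge_seq omega (enum (~: A))) J'u.
    (* Multiplying [u], which is 0 modulo J', by the complement of A leaves Omega /\ xi_A up to
       sign. *)
    rewrite uE mulr_sumr (bigD1 A) /=; last exact/eqP.
    rewrite big1 ?addr0 => [|B /andP [/eqP Br BA]].
      have [d] := wedge_seq_setC_mul omega (erefl #|A|).
      rewrite eqxx mulrA => ->; rewrite -(ext_scalerAl (_ ^+ d)).
      exact: ext_mod_sign.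
    have [|d] := wedge_seq_setC_mul omega (A := A) (B := B); first by rewrite Ar Br.
    by rewrite mulrA eq_sym (negPf BA) => ->; rewrite mul0r.
  have Dz : ext_pow M D (xi A - z).
    rewrite -scaleN1r; apply: lspanD; first exact: Dxi.
    by apply/lspanZ/(skew_seq_ext_pow sz).
  have [w [Dw Jw]] := ext_mod_split basis_e idealJ Dz J'z.
  by exists (z, w).
pose sumE (F : {set 'I_k} -> E) :=
  \sum_(A : {set 'I_k} | #|A| == r.+1) wedge_seq omega (enum A) * F A.
have skew_sum F : (forall A : {set 'I_k}, #|A| = r.+1 -> ext_pow M D (F A)) ->
    skew r.+1 p (sumE F).
  move=> DF; apply: lspan_sum => A /eqP Ar; apply: lspan_sub.
  exists (enum A), D, (F A); split=> //; last exact: DF.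
  - by rewrite -cardE.
  - by move=> i _; rewrite mem_enum.
pose eta' := eta - sumE (fun A => (y A).2).
have skew_w : skew r.+1 p (sumE (fun A => (y A).2)).
  by apply: skew_sum => A /yP [].
have skew_z : skew r.+2 p (sumE (fun A => (y A).1)).
  apply: lspan_sum => A /eqP Ar; have [sz _ _] := yP A Ar.
  apply: (lspan_linear (phi := ext_lmul (wedge_seq omega (enum A))) _ sz).
  move=> _ [t [q [beta [st _ qD qb ->]]]]; apply: lspan_sub.
  exists (enum A ++ t), q, beta; split=> //.
  - by rewrite size_cat st -cardE Ar addn1.
  - by move=> i _; rewrite mem_enum.
  - by rewrite pE -qD addnA addn1.
  - by rewrite wedge_seq_cat -mulrA.
have Jeta' : ext_mod J (a ^+ k *: eta' - sumE (fun A => (y A).1)).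
  suff -> : a ^+ k *: eta' - sumE (fun A => (y A).1) = (a ^+ k *: eta - u) +
      sumE (fun A => xi A - (y A).1 - a ^+ k *: (y A).2).
    apply: ext_modD => //; apply: ext_mod_sum => // A /eqP /yP [_ _].
    exact: ext_mod_mul.
  rewrite uE /eta' scalerBr /sumE scaler_sumr.
  under [X in _ = _ + X]eq_bigr do rewrite !mulrBr -ext_scalerAr.
  by rewrite !sumrB -!addrA; congr (_ + _); rewrite addKr addrC.
have peta' : ext_pow M p eta'.
  rewrite /eta' -scaleN1r; apply: lspanD; first exact: peta.
  exact/lspanZ/(skew_seq_ext_pow skew_w).
have rs' : (r.+2 + s = k + 1)%N by rewrite -rs addnS.
have pr' : (p + 1 = r.+2 + D)%N by rewrite pE addn1 -addSn.
have [t ts|u' [su' Ju']] := IHD J (a :: l) r.+2 s p eta' idealJ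
    (conj nzd_a reg) forms (ltnW szl) rs' pr' peta'.
  (* Modulo J, a^k eta' has r + 2 factors omega_i, so s of them already annihilate it instead of s +
     1; then a^k cancels. *)
  apply: (ext_mod_nzd (nzd_an k)).
  have := ext_mod_mul (wedge_seq omega t) Jeta'.
  rewrite mulrBr (skew_seq_kill _ _ skew_z) ?subr0 -?ext_scalerAr //.
    by move=> i _; rewrite mem_enum.
  by rewrite size_enum_ord ts addnC rs' addn1.
exists (u' + sumE (fun A => (y A).2)); split.
  by apply: lspanD => //; exact: skew_seq_le.
by rewrite opprD addrCA addrC.
Qed.

Lemma annihilates_wedge_seq s (eta : E) t :
  annihilates (lspan (range omega)) s eta -> size t = s -> wedge_seq omega t * eta = 0.
Proof.
move=> ann /eqP ts; rewrite (wedge_seq_tuple omega (Tuple ts)); apply: ann => i.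
exact/lspan_sub/imageP.
Qed.

(** Expanding the nu_i in the omega_j puts r + s = k + 1 factors among only k vectors. *)
Lemma skew_annihilates r s p (eta : E) : (r + s = k + 1)%N -> skew r p eta ->
  annihilates (lspan (range omega)) s eta.
Proof.
move=> rs seta nu Nnu.
have := wedge_mul_skew_seq Nnu (ext_pow1 M); rewrite mulr1 addn0 => snu.
apply: (lspan_ind (P := fun w : E => w * eta = 0) _ _ _ _ snu).
- exact: mul0r.
- by move=> x y x0 y0; rewrite mulrDl x0 y0 addr0.
- by move=> a x x0; rewrite -(ext_scalerAl a) x0 scaler0.
- move=> _ [t [q [beta [ts tk sq qb ->]]]].
  have [a ->] : exists a, beta = a *: (1 : E).
    by apply: ext_pow0; move: sq; rewrite -[RHS]addn0 => /addnI <-.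
  rewrite -(ext_scalerAr a) mulr1 -(ext_scalerAl a) (skew_seq_kill _ _ seta) //.
    exact: scaler0.
  by rewrite size_enum_ord ts addnC rs addn1.
Qed.

End Division.

(** * From depth to regular sequences, and the conclusion *)

(** By contraposition: without a sequence longer than d + 1, the number d + 1 bounds all lengths and
    hence the supremum. The first alternative is the case of infinite depth by convention. *)
Lemma depth_regular_seq (R : comPzRingType) (I : set R) (d : nat) :
  (d%:Z%:E <= depth I - 2%:E)%E ->
  I 1 \/ exists l : seq R, [/\ regular_seq l, [set` l] `<=` I & (d.+1 < size l)%N].
Proof.
rewrite /depth; case: asboolP => [->|_]; first by left.
set S := [set _ | _ in _] => dS; right; apply: contrapT => no_seq.
have ubS : ubound S (d.+1%:Z)%:E.
  move=> _ [l [regl lI] <-]; rewrite lee_fin lez_nat leqNgt.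
  by apply/negP => dl; apply: no_seq; exists l.
have : (supremum 0%E S <= (d.+1%:Z)%:E)%E.
  (* The supremum of the empty set is the default 0, which respects the bound. *)
  rewrite /supremum; case: ifP => _; first by rewrite lee_fin.
  by case: xgetP => [x _ [_ /(_ _ ubS)]|_] //; rewrite lee_fin.
move: dS; case: (supremum _ _) => [x| |] //.
rewrite -EFinB !lee_fin => dx xd; have := le_trans dx (lerB xd (lexx 2)).
by rewrite -[d.+1]addn1 PoszD -addrA lerDl.
Qed.

Theorem theorem2p11 (R : comPzRingType) (M : lmodType R)
    (m : nat) (e : 'I_m -> M) (he : is_basis setT e)
    (N : set M) (k : nat) (omega : 'I_k -> M) (homega : is_basis N omega)
    (p r s : nat)
    (hp : (1 <= p <= m)%N) (hr : (1 <= r <= m)%N) (hs : (1 <= s <= m)%N)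
    (hrp : (r <= p)%N) (hrs : (r + s = k + 1)%N) :
  [/\ ((p%:Z - r%:Z)%:E <= depth (coef_ideal e omega) - 2%:E)%E ->
        forall eta : exterior M, ext_pow M p eta ->
          skew_tensor N r (p - r) eta <-> annihilates N s eta,
      forall eta : exterior M, ext_pow M p eta -> annihilates N s eta ->
        exists n : nat, (0 < n)%N /\
          forall a : R, coef_ideal e omega a ->
            skew_tensor N r (p - r) (a ^+ n *: eta),
      fin_gen [set eta | ext_pow M p eta /\ annihilates N s eta] ->
        exists n : nat, (0 < n)%N /\
          forall eta : exterior M, ext_pow M p eta -> annihilates N s eta ->
            forall a : R, coef_ideal e omega a ->
              skew_tensor N r (p - r) (a ^+ n *: eta)
    & forall eta : exterior M, ext_pow M p eta ->
        forall (a : R) (n : nat), GRing.lreg a -> (0 < n)%N ->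
          skew_tensor N r (p - r) (a ^+ n *: eta) ->
          annihilates N s eta].
Proof.
have [-> _] := homega.
have skewE eta : skew_tensor (lspan (range omega)) r (p - r) eta <->
    skew_seq omega (enum 'I_k) r p eta.
  have := @skew_tensor_skew_seq R M k omega r (p - r) eta.
  have := @skew_seq_skew_tensor R M k omega r (p - r) eta.
  by rewrite subnKC.
have ideal0 : is_ideal [set (0 : R)].
  by split=> // [x y -> ->|a x ->]; rewrite ?addr0 ?mulr0.
have mod0 s' eta : annihilates (lspan (range omega)) s' eta ->
    forall t, size t = s' -> ext_mod [set 0] (wedge_seq omega t * eta).
  move=> ann t ts; rewrite (annihilates_wedge_seq ann ts); exact: ext_mod0.
(* Congruence modulo the zero ideal is equality in a fixed degree, because M is free. *)
have eq_mod0 u w : ext_pow M p u -> skew_seq omega (enum 'I_k) r p w ->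
    ext_mod [set 0] (u - w) -> u = w.
  move=> pu sw uw; apply/eqP; rewrite -subr_eq0; apply/eqP.
  apply: (ext_mod_zero he (p := p)) uw; rewrite -scaleN1r.
  by apply/lspanD/lspanZ/(skew_seq_ext_pow sw).
have part_ii eta a : ext_pow M p eta -> annihilates (lspan (range omega)) s eta ->
    coef_ideal e omega a -> skew_tensor (lspan (range omega)) r (p - r) (a ^+ k *: eta).
  move=> peta /mod0 ann /(coef_ideal_forms he) forms; apply/skewE.
  have [u [su uE]] := skew_expr ideal0 forms hrs peta ann.
  by rewrite (eq_mod0 _ _ _ su uE) //; exact: lspanZ.
have k_gt0 : (0 < k)%N.
  case/andP: hr => r0 _; case/andP: hs => s0 _.
  by rewrite -ltnS -[k.+1]addn1 -hrs (leq_add r0 s0).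
split.
- rewrite subzn // => /depth_regular_seq depthI eta peta; split.
    by move=> /skewE /(skew_annihilates hrs).
  move=> ann; case: depthI => [I1|[l [regl lI szl]]].
    (* When I(N) = R, part (ii) with a = 1 already gives membership. *)
    by have := part_ii eta 1 peta ann I1; rewrite expr1n scale1r.
  have forms a : a \in l -> dual_forms omega a.
    by move=> al; apply: (coef_ideal_forms he); exact: lI.
  have pr : (p + 1 = r + (p - r).+1)%N by rewrite addn1 addnS subnKC.
  have [u [su uE]] := skew_of_weakly_regular he ideal0
    (regular_seq_weakly_regular regl) forms szl hrs pr peta (mod0 _ _ ann).
  by apply/skewE; rewrite (eq_mod0 _ _ peta su uE).
- by move=> eta peta ann; exists k; split=> // a; exact: part_ii.
- by move=> _; exists k; split=> // eta peta ann a; exact: part_ii.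
- move=> eta peta a n rega _ /skewE /(skew_annihilates hrs) ann nu Nnu.
  (* The power a^n is cancelled in degree s + p, where nu /\ eta lives. *)
  apply: (ext_pow_lreg he (a := a ^+ n) (p := (s + p)%N)).
  + exact: GRing.lregX.
  + exact: skew_seq_ext_pow (wedge_mul_skew_seq Nnu peta).
  + by rewrite (ext_scalerAr (a ^+ n)); exact: ann.
Qed.
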